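(* Let $n\ge 3$ and let $t$ be an integer with $3\le t\le n$. Assign threshold $t$ to every vertex of $K_{1,n}\Box K_{1,n}$. Then $dyn_t(K_{1,n}\Box K_{1,n})=n^2$.
   Context: $K_{1,n}$ is the star with one center and $n$ leaves; $G\Box H$ is the Cartesian product (vertex set $V(G)\times V(H)$, $(u,v)\sim(u',v')$ iff $u=u'$ and $vv'\in E(H)$, or $v=v'$ and $uu'\in E(G)$). For constant threshold $t$, a set $D$ of vertices is a $t$-dynamic monopoly if starting from $D$ and repeatedly adding any vertex having at least $t$ neighbors in the current set eventually yields all vertices (a vertex of degree less than $t$ can thus only belong to the final set by being in $D$); $dyn_t$ is the minimum size of a $t$-dynamic monopoly. *)

(* Defs.v *)
From HB Require Import structures.
From mathcomp Require Import all_boot.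

Set Implicit Arguments.
Unset Strict Implicit.
Unset Printing Implicit Defensive.

Record sgraph := SGraph {
  vertex :> finType;
  adj : rel vertex;
  adj_sym : symmetric adj;
  adj_irr : irreflexive adj }.

(* The centre of the star is None and its n leaves are the Some i. *)
Definition star_adj (n : nat) : rel (option 'I_n) :=
  fun u v => (u == None) != (v == None).

Lemma star_adj_sym n : symmetric (@star_adj n).
Proof. by move=> u v; rewrite /star_adj eq_sym. Qed.

Lemma star_adj_irr n : irreflexive (@star_adj n).
Proof. by move=> u; rewrite /star_adj eqxx. Qed.

Definition star (n : nat) : sgraph :=
  SGraph (@star_adj_sym n) (@star_adj_irr n).

Definition cart_adj (G H : sgraph) : rel (G * H)%type :=
  fun x y => (x.1 == y.1) && adj x.2 y.2 || (x.2 == y.2) && adj x.1 y.1.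

Lemma cart_adj_sym G H : symmetric (@cart_adj G H).
Proof.
move=> x y; rewrite /cart_adj [x.1 == _]eq_sym [x.2 == _]eq_sym.
by rewrite (adj_sym x.1) (adj_sym x.2).
Qed.

Lemma cart_adj_irr G H : irreflexive (@cart_adj G H).
Proof. by move=> x; rewrite /cart_adj !adj_irr !andbF. Qed.

Definition cartesian_product (G H : sgraph) : sgraph :=
  SGraph (@cart_adj_sym G H) (@cart_adj_irr G H).

Section DynamicMonopoly.

Variables (G : sgraph) (tau : G -> nat).

Definition activate (X : {set G}) : {set G} :=
  X :|: [set v | tau v <= #|[set u in X | adj v u]|].

Definition dynamic_monopoly (D : {set G}) : Prop :=
  exists k, iter k activate D = [set: G].

(* Each non-stationary round adds a vertex, so #|G| rounds suffice. *)
Definition dynamic_monopolyb (D : {set G}) : bool :=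
  iter #|G| activate D == [set: G].

Lemma activateT : activate [set: G] = [set: G].
Proof. by rewrite /activate setTU. Qed.

Lemma dynamic_monopolyP D :
  reflect (dynamic_monopoly D) (dynamic_monopolyb D).
Proof.
apply: (iffP eqP) => [eqT|[k eqT]]; first by exists #|G|.
have grow m : activate (iter m activate D) = iter m activate D \/
              m <= #|iter m activate D|.
  elim: m => [|m [eqm|lem]]; [by right | by left; rewrite /= !eqm |].
  have := subsetUl (iter m activate D)
    [set v | tau v <= #|[set u in iter m activate D | adj v u]|].
  rewrite -/(activate _) subEproper => /orP[/eqP eqm|/proper_card lt].
    by left; rewrite /= -!eqm.
  by right; apply: leq_ltn_trans lem lt.
have [st|le] := grow #|G|; last first.
  by apply/eqP; rewrite eqEcard subsetT cardsT.
have [lek|/ltnW lek] := leqP #|G| k.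
  rewrite -(subnK lek) iterD in eqT; rewrite -eqT.
  by elim: (k - _) => //= j <-; rewrite st.
rewrite -(subnK lek) iterD eqT.
by elim: (_ - _) => //= j ->; exact: activateT.
Qed.

Definition dyn : nat :=
  #|[arg min_(D < [set: G] | dynamic_monopolyb D) #|D|]|.

Lemma dynamic_monopolyT : dynamic_monopolyb [set: G].
Proof. by apply/dynamic_monopolyP; exists 0. Qed.

Lemma dyn_attained : exists2 D, dynamic_monopoly D & #|D| = dyn.
Proof.
rewrite /dyn; case: arg_minnP => [|D /dynamic_monopolyP mD _].
  exact: dynamic_monopolyT.
by exists D.
Qed.

Lemma dyn_min D : dynamic_monopoly D -> dyn <= #|D|.
Proof.
move=> /dynamic_monopolyP mD; rewrite /dyn.
by case: arg_minnP => [|E _ ->//]; exact: dynamic_monopolyT.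
Qed.

End DynamicMonopoly.

(* Main.v *)
Require Import Defs.
From mathcomp Require Import all_boot.

(** A pair of leaves has degree 2 < t, so all n^2 of them lie in every dynamic
    monopoly.  Conversely they form one: the pairs with exactly one centre
    have n neighbours among them, and then the pair of centres has 2n active
    neighbours. *)

Section DegreeBounds.

Variables (G : sgraph) (tau : G -> nat).

(** Joining in some round would take [tau v] active neighbours, more than [v] has in all; going back
    round by round, [v] must have been in [D] from the start. *)
Lemma dynamic_monopoly_low_degree (D : {set G}) (v : G) :
  dynamic_monopoly tau D -> #|[set u | adj v u]| < tau v -> v \in D.
Proof.
move=> [k kT] deg_v; have: v \in iter k (activate tau) D by rewrite kT inE.
elim: k {kT} => //= k IHk; rewrite !inE => /orP[//|].
rewrite leqNgt (leq_ltn_trans _ deg_v) //; apply: subset_leq_card.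
by apply/subsetP=> u; rewrite !inE => /andP[].
Qed.

(** The values of [f] are [n] distinct active neighbours of [v], so a lower bound on the count needs
    no description of the whole neighbourhood. *)
Lemma activate_injective (n : nat) (f : 'I_n -> G) (X : {set G}) (v : G) :
    injective f -> (forall i, f i \in X) -> (forall i, adj v (f i)) ->
  tau v <= n -> v \in activate tau X.
Proof.
move=> f_inj fX vf le_n; rewrite !inE; apply/orP; right.
rewrite (leq_trans le_n) // -[leqLHS]card_ord -(card_imset _ f_inj).
apply: subset_leq_card; apply/subsetP=> _ /imsetP[i _ ->].
by rewrite inE fX vf.
Qed.

End DegreeBounds.

Definition leaf_pairs (n : nat) : {set cartesian_product (star n) (star n)} :=
  setX [set~ None] [set~ None].

Lemma card_leaf_pairs n : #|leaf_pairs n| = n ^ 2.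
Proof. by rewrite cardsX !cardsC1 !card_option card_ord. Qed.

(** A leaf is adjacent only to the centre, so a neighbour arises by moving exactly one coordinate to
    [None]. *)
Lemma leaf_pair_degree n (i j : 'I_n) :
  #|[set u | @adj (cartesian_product (star n) (star n)) (Some i, Some j) u]|
    <= 2.
Proof.
rewrite (leq_trans _ (card_size [:: (Some i, None); (None, Some j)])) //.
apply: subset_leq_card; apply/subsetP=> -[[a|] [b|]];
  rewrite !inE /= /cart_adj /= /star_adj /= ?andbF //= ?andbT ?orbF => /eqP[->];
  by rewrite eqxx ?orbT.
Qed.

Lemma leaf_pairs_dynamic_monopoly n t :
    t <= n ->
  dynamic_monopoly (G := cartesian_product (star n) (star n)) (fun _ => t)
    (leaf_pairs n).
Proof.
(* Two rounds: the first adds the pairs with exactly one centre, the second the pair of centres. *)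
move=> le_tn; exists 2; apply/setP=> v; rewrite [RHS]inE /=.
set act := activate _; set L := leaf_pairs n.
pose G := cartesian_product (star n) (star n).
have incr (X : {set G}) w : w \in X -> w \in act X by rewrite !inE => ->.
have leaf i j : (Some i, Some j) \in L by rewrite !inE.
have centre_leaf j : (None, Some j) \in act L.
  apply: (@activate_injective G (fun=> t) n (fun i => (Some i, Some j))) => //.
    by move=> a b [].
  by move=> i; rewrite /= /cart_adj /= eqxx.
case: v => [[i|] [j|]].
- by rewrite !incr.
- apply: incr.
  apply: (@activate_injective G (fun=> t) n (fun j => (Some i, Some j))) => //.
    by move=> a b [].
  by move=> j; rewrite /= /cart_adj /= eqxx.
- exact: incr.
(* Half of the [2n] neighbours of the pair of centres already suffice, since [t <= n]; [centre_leaf]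
   shows that these are active after round one. *)
- by apply: (@activate_injective G (fun=> t) n (fun j => (None, Some j))) => // a b [].
Qed.

Theorem theorem11 (n t : nat) (hn : 3 <= n) (ht : 3 <= t <= n) :
  dyn (G := cartesian_product (star n) (star n)) (fun _ => t) = n ^ 2.
Proof.
case/andP: ht => t_ge3 le_tn; apply/eqP; rewrite eqn_leq -card_leaf_pairs.
apply/andP; split; first exact/dyn_min/leaf_pairs_dynamic_monopoly.
have [D monoD <-] :=
  @dyn_attained (cartesian_product (star n) (star n)) (fun _ => t).
(* It suffices that the minimum monopoly [D] contains every leaf pair. *)
apply: subset_leq_card; apply/subsetP=> -[[i|] [j|]]; rewrite ?inE //= => _.
apply: dynamic_monopoly_low_degree monoD _.
exact: leq_ltn_trans (leaf_pair_degree n i j) t_ge3.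
Qed.
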